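(* Let $M=[0,1]^2$ with the flat metric, let $(\phi_k)_{k\ge 1}$ be the Dirichlet Laplacian eigenfunctions $\sin(m\pi x)\sin(n\pi y)$, $m,n\in\mathbb{Z}_{\geq 1}$, enumerated so that the corresponding eigenvalues $\lambda_k$ are nondecreasing, and let $$ f_N(x,y) = \sum_{1 \leq k \leq N} \frac{1}{\sqrt{\lambda_k}} \frac{|\phi_k(x,y)|}{\|\phi_k\|_{L^{\infty}(M)}}.$$ Then: (i) For every fixed $0<y<1$ and every rational $p/q\in(0,1)$, the function $f_N(\cdot,y)$ has a local minimizer at $x=p/q$ for all $N$ sufficiently large. (ii) For every fixed $0<x<1$ and every rational $r/s\in(0,1)$, the function $f_N(x,\cdot)$ has a local minimizer at $y=r/s$ for all $N$ sufficiently large. (iii) For every $(p/q,r/s)\in\mathbb{Q}^2\cap(0,1)^2$, the function $f_N$ (as a function of two variables) has a strict local minimizer at $(p/q,r/s)$ for all $N$ sufficiently large.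
   Context: The Laplacian on $[0,1]^2$ is taken with Dirichlet boundary conditions, $-\Delta\phi_k=\lambda_k\phi_k$. The eigenfunction $\sin(m\pi x)\sin(n\pi y)$ has eigenvalue $\pi^2(m^2+n^2)$ and $L^\infty$-norm $1$. Eigenfunctions with the same eigenvalue are enumerated in an arbitrary but fixed order. ''For all $N$ sufficiently large'' means that there is a threshold $N_0$, which may depend on the points under consideration ($y$ and $p/q$ in (i), $x$ and $r/s$ in (ii), $p/q$ and $r/s$ in (iii)), such that the assertion holds for all integers $N\geq N_0$. *)

(* Defs.v *)
From HB Require Import structures.
From mathcomp Require Import all_boot all_order all_algebra.
From mathcomp Require Import all_classical all_reals all_analysis.
Import numFieldNormedType.Exports.
Import Order.TTheory GRing.Theory Num.Theory.

Set Implicit Arguments.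
Unset Strict Implicit.
Unset Printing Implicit Defensive.

Local Open Scope classical_set_scope.
Local Open Scope ring_scope.

Section Defs.
Context {R : realType}.
Implicit Types (phi : R * R -> R) (z : R * R).

Definition unit_square : set (R * R) := `[0, 1] `*` `[0, 1].

Definition laplacian phi z : R :=
  'D_((1, 0) : R * R) ('D_((1, 0) : R * R) phi) z +
  'D_((0, 1) : R * R) ('D_((0, 1) : R * R) phi) z.

(* 'D_v is a total operator, hence the explicit derivability conditions. *)
Definition twice_derivable phi z : Prop :=
  forall v : R * R, v = (1, 0) \/ v = (0, 1) ->
    (\forall w \near z, derivable phi w v) /\ derivable ('D_v phi) z v.

(* [unit_square°] is the interior in the plane, so the third clause is the
   Dirichlet condition on the topological boundary. *)
Definition dirichlet_eigenpair (lam : R) phi : Prop :=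
  [/\ exists2 z, unit_square z & phi z != 0,
      {within unit_square, continuous phi},
      forall z, unit_square z -> ~ unit_square° z -> phi z = 0 &
      forall z, unit_square° z ->
        twice_derivable phi z /\ - laplacian phi z = lam * phi z].

Definition mode (mn : nat * nat) z : R :=
  sin (mn.1%:R * pi * z.1) * sin (mn.2%:R * pi * z.2).

(* The essential supremum over the square, obtained from the L^oo norm on the
   plane of the extension of [phi] by zero. *)
Definition Linfty_norm phi : R :=
  fine (Lnorm (@lebesgue_measure R \x @lebesgue_measure R)%E +oo%E
    (EFin \o (phi \_ unit_square))).

(* Eigenpairs are numbered from 1; [lam 0] and [phi 0] are never used. *)
Definition fN (lam : nat -> R) (phi : nat -> R * R -> R) (N : nat) z : R :=
  \sum_(1 <= k < N.+1)
    (Num.sqrt (lam k))^-1 * (`|phi k z| / Linfty_norm (phi k)).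

End Defs.

(* Minimality is relative to the domain [D]. *)
Definition local_minimizer {R : realType} {T : topologicalType}
    (D : set T) (f : T -> R) (a : T) : Prop :=
  D a /\ \forall x \near within D (nbhs a), f a <= f x.

Definition strict_local_minimizer {R : realType} {T : topologicalType}
    (D : set T) (f : T -> R) (a : T) : Prop :=
  D a /\ \forall x \near within D (nbhs a), x != a -> f a < f x.

(* Main.v *)
Require Import Defs.
From mathcomp Require Import all_boot all_order all_algebra.
From mathcomp Require Import all_classical all_reals all_analysis.
From mathcomp Require Import ess_sup_inf ring lra zify.
Import numFieldNormedType.Exports.
Import Order.TTheory GRing.Theory Num.Theory.
Local Open Scope classical_set_scope.
Local Open Scope ring_scope.

(** The idea is a competition between cusps and cancellation. Write the modes as
    pairs (m, n); up to the factor 1 / pi, the sum [fN] runs over the first N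
    pairs of the terms |sin (m pi x)| |sin (n pi y)| / sqrt (m^2 + n^2). Since the
    eigenvalues are pi^2 (m^2 + n^2) ([mode_eigenvalue]) and the modes have
    sup norm 1 ([Linfty_norm_mode]), these pairs fill a quarter disc, up to
    ties on its boundary circle, of radius tending to infinity with N.

    Fix a = p / q in lowest terms and look at the first-order variation in x at a. If q
    divides m, then |sin (m pi x)| vanishes at a with a cusp and grows like
    m pi |x - a| on both sides. If not, it has the slope m pi g(m) with
    g(m) = sgn (sin (m pi a)) cos (m pi a), which can have either sign. But g is
    q-periodic and its sum over a period is 0 ([sum_slope_period]), since it
    changes sign under m -> q - m. For each n the weight m / sqrt (m^2 + n^2) is
    monotone in m and at most 1, so by Abel summation the smooth terms with that
    n contribute at most 2 q ([slope_error_le]): O(K) altogether, when the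
    disc has radius of order K. The cusps alone contribute at least a constant
    times K^2, because the average of |sin (n pi y)| over n is bounded below
    ([sum_norm_sin_ge]). Hence for K large, with a threshold that depends on y
    only through a lower bound for |sin (pi y)|, the cusps win
    ([slope_sum_ge]), and the sum grows linearly on both sides of a
    ([modal_sum_gt]).

    This gives strict minimality along the horizontal line through (a, y),
    uniformly for y near a given point ([first_modes_sum_gt_fst]); exchanging the
    coordinates gives the vertical statement. The uniformity yields the
    two-variable statement: the increment from (a, b) to (x, y) is the sum of a
    vertical one on the line x = a and a horizontal one at height y, which
    is close to b. *)

Set Implicit Arguments.
Unset Strict Implicit.
Unset Printing Implicit Defensive.

(** * First-order bounds for the sine *)

(** The mean value theorem at 0, for increments of either sign. *)
Lemma mvt_at0 (R : realType) (f df : R -> R) (x : R) :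
  (forall z : R, is_derive z 1 f (df z)) ->
  exists2 c, `|c| <= `|x| & f x - f 0 = df c * x.
Proof.
move=> fE.
have fc : continuous f.
  move=> z; apply/differentiable_continuous/derivable1_diffP.
  exact: (@ex_derive _ _ _ _ _ _ _ (fE z)).
have fw a b : {within `[a, b], continuous f} by apply: continuous_subspaceT.
have [x0|x0] := leP 0 x.
  have [c + ->] := MVT_segment x0 (fun z _ => fE z) (fw _ _).
  by rewrite in_itv /= => /andP[c0 cx]; exists c; rewrite ?subr0 // !ger0_norm.
have [c + h] := MVT_segment (ltW x0) (fun z _ => fE z) (fw _ _).
rewrite in_itv /= => /andP[cx c0]; exists c.
  by rewrite !ler0_norm ?lerN2 // ltW.
by rewrite -opprB h sub0r mulrN opprK.
Qed.

Lemma sin_le_norm (R : realType) (x : R) : `|sin x| <= `|x|.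
Proof.
have [c _] := @mvt_at0 R sin cos x (fun z => is_derive_sin z).
rewrite sin0 subr0 => ->; rewrite normrM ler_piMl //; exact: cos_max.
Qed.

Lemma cos_ge1B (R : realType) (x : R) : 1 - x ^+ 2 <= cos x.
Proof.
have [c cx] := @mvt_at0 R cos (fun z => - sin z) x (fun z => is_derive_cos z).
rewrite cos0 => h; have {h}-> : cos x = 1 - sin c * x by move: h; lra.
rewrite lerD2l lerN2 (le_trans (ler_norm _)) // normrM -[leRHS]ger0_norm ?sqr_ge0 //.
by rewrite normrX expr2 ler_pM // (le_trans (sin_le_norm _)).
Qed.

Lemma sin_sub_le (R : realType) (x : R) : `|sin x - x| <= x ^+ 2.
Proof.
have d (z : R) : is_derive z 1 (fun z : R => sin z - z) (cos z - 1).
  by apply: is_deriveB.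
have [c cx] := @mvt_at0 R (fun z => sin z - z) _ x d.
rewrite sin0 !subr0 => ->.
rewrite normrM -normr1 -[x ^+ 2]ger0_norm ?sqr_ge0 // normrX expr2 ler_pM //.
have [e ec] := @mvt_at0 R cos (fun z => - sin z) c (fun z => is_derive_cos z).
rewrite cos0 normr1 => ->; rewrite normrM normrN.
apply: le_trans cx; rewrite ler_piMl //; exact: sin_max.
Qed.

(** With s = sgn (sin t), the bound |z| >= s z applied to
    z = sin (t + u) = sin t cos u + cos t sin u is exact to first order,
    as long as sin t is not 0. *)
Lemma norm_sinD_ge (R : realType) (t u : R) :
  `|sin t| + Num.sg (sin t) * cos t * u - 2 * u ^+ 2 <= `|sin (t + u)|.
Proof.
rewrite sinD; set s := Num.sg (sin t).
have s1 : `|s| <= 1 by rewrite /s normr_sg; case: eqP; rewrite ?lexx ?ler01.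
have e : s * sin t = `|sin t| by rewrite -normrEsg.
have h1 : s * (sin t * cos u + cos t * sin u) <= `|sin t * cos u + cos t * sin u|.
  rewrite (le_trans (ler_norm _)) // normrM ler_piMl //.
apply: le_trans h1; rewrite mulrDr !mulrA e.
have h2 : `|sin t| - u ^+ 2 <= `|sin t| * cos u.
  have := cos_ge1B u; have := sin_max t; have := normr_ge0 (sin t).
  have := sqr_ge0 u; nra.
have h3 : `|s * cos t * (sin u - u)| <= u ^+ 2.
  rewrite normrM -[leRHS]mul1r ler_pM // ?sin_sub_le //.
  by rewrite normrM -[leRHS]mul1r ler_pM // cos_max.
move: h3; rewrite ler_norml mulrBr => /andP[h3 _].
move: h2 h3; set a := s * cos t * u; set b := s * cos t * sin u; lra.
Qed.

Lemma norm_sinD_ge0 (R : realType) (t u : R) : sin t = 0 ->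
  `|u| - u ^+ 2 <= `|sin (t + u)|.
Proof.
move=> t0; rewrite sinD t0 mul0r add0r normrM (sin0cos1 t0) mul1r.
have h := sin_sub_le u; have := ler_normD (sin u) (u - sin u).
rewrite addrC subrK [`|u - _|]distrC; lra.
Qed.

(** * Cancellation of the slopes at a rational point *)

(** The derivative of [fun t => `|sin t|] where the sine does not vanish, and 0 at
    its cusps. *)
Definition slope {R : realType} (t : R) : R := Num.sg (sin t) * cos t.

Lemma slopeDpi (R : realType) : periodic (@slope R) pi.
Proof. by move=> t; rewrite /slope sinDpi cosDpi sgrN mulrNN. Qed.

Lemma slopeN (R : realType) (t : R) : slope (- t) = - slope t.
Proof. by rewrite /slope sinN cosN sgrN mulNr. Qed.

Lemma norm_slope_le1 (R : realType) (t : R) : `|slope t| <= 1.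
Proof.
rewrite /slope normrM normr_sg -[leRHS]mulr1 ler_pM // ?cos_max //.
by case: eqP.
Qed.

Lemma slope_period (R : realType) (a : R) (p q m : nat) : a * q%:R = p%:R ->
  slope ((m + q)%:R * pi * a) = slope (m%:R * pi * a).
Proof.
move=> aq; rewrite -[RHS](periodicn (@slopeDpi R) p); congr slope.
rewrite -[pi *+ p]mulr_natl -aq natrD; ring.
Qed.

(** The reflection m -> q - m of {0, ..., q} takes m pi a to p pi - m pi a, where
    the slope has the opposite value because it is odd and pi-periodic. *)
Lemma sum_slope_period (R : realType) (a : R) (p q : nat) : a * q%:R = p%:R ->
  \sum_(m < q) slope (m.+1%:R * pi * a) = 0.
Proof.
move=> aq; set h : nat -> R := fun m => slope (m%:R * pi * a).
have h0 : h 0%N = 0 by rewrite /h /slope !mul0r sin0 sgr0 mul0r.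
have -> : \sum_(m < q) h m.+1 = \sum_(m < q.+1) h m.
  by rewrite big_ord_recl h0 add0r.
suff : \sum_(m < q.+1) h m = - \sum_(m < q.+1) h m by lra.
rewrite {1}(reindex_inj rev_ord_inj) /= -sumrN; apply: eq_bigr => m _.
rewrite subSS /h -slopeN -[RHS](periodicn (@slopeDpi R) p); congr slope.
rewrite -[pi *+ p]mulr_natl -aq natrB ?leq_ord //; ring.
Qed.

(** Full periods cancel, and what is left has fewer than q terms. *)
Lemma norm_periodic_sum_le (R : realType) (g : nat -> R) (q k : nat) :
  (0 < q)%N -> (forall i, g (i + q)%N = g i) -> (forall i, `|g i| <= 1) ->
  \sum_(i < q) g i = 0 -> `|\sum_(i < k) g i| <= q%:R.
Proof.
move=> q0 gq g1 S0; elim/ltn_ind: k => k IH.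
have [kq|qk] := ltnP k q.
  rewrite (le_trans (ler_norm_sum _ _ _)) //.
  apply: (@le_trans _ _ (\sum_(i < k) 1)); first by apply: ler_sum => i _.
  by rewrite sumr_const card_ord ler_nat ltnW.
rewrite -(subnKC qk) big_split_ord /= S0 add0r.
under eq_bigr do rewrite addnC gq.
by apply: IH; lia.
Qed.

(** Summation by parts; the induction compares the sum with w_M G_M. *)
Lemma abel_le (R : realType) (w g : nat -> R) (C : R) (M : nat) :
  (forall i, 0 <= w i) -> (forall i, w i <= w i.+1) ->
  (forall k, `|\sum_(i < k) g i| <= C) ->
  `|\sum_(i < M) w i * g i| <= 2 * C * w M.
Proof.
move=> w0 wS gC.
have C0 : 0 <= C := le_trans (normr_ge0 _) (gC 0%N).
have key : `|\sum_(i < M) w i * g i - w M * \sum_(i < M) g i| <= C * w M.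
  elim: M => [|M IH].
    by rewrite !big_ord0 mulr0 subr0 normr0 mulr_ge0.
  rewrite (_ : _ - _ = \sum_(i < M) w i * g i - w M * \sum_(i < M) g i
      - (w M.+1 - w M) * \sum_(i < M.+1) g i); last first.
    by rewrite !big_ord_recr /=; ring.
  rewrite (le_trans (ler_normB _ _)) // normrM.
  rewrite [`|w M.+1 - w M|]ger0_norm ?subr_ge0 //.
  have := ler_wpM2l _ (gC M.+1); move=> /(_ (w M.+1 - w M)).
  rewrite subr_ge0 wS => /(_ isT); move: IH; lra.
have h : `|w M * \sum_(i < M) g i| <= C * w M.
  by rewrite normrM (ger0_norm (w0 M)) mulrC ler_wpM2r.
have := ler_normD (\sum_(i < M) w i * g i - w M * \sum_(i < M) g i)
  (w M * \sum_(i < M) g i).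
rewrite subrK; move: key h; lra.
Qed.

(** * The contribution of the cusps *)

(** At m, n: the slope with which a term of the sum leaves one of its cusps in the
    x-direction, up to the factor pi |sin (n pi y)|. *)
Definition weight {R : realType} (x y : R) : R := x / Num.sqrt (x ^+ 2 + y ^+ 2).

Lemma weight_ge0 (R : realType) (x y : R) : 0 <= x -> 0 <= weight x y.
Proof. by move=> x0; rewrite divr_ge0. Qed.

Lemma weight_le1 (R : realType) (x y : R) : 0 <= x -> 0 < y -> weight x y <= 1.
Proof.
move=> x0 y0; have xy0 : 0 < x ^+ 2 + y ^+ 2 by rewrite ltr_wpDl ?sqr_ge0 ?exprn_gt0.
rewrite ler_pdivrMr ?sqrtr_gt0 // mul1r -[leLHS]ger0_norm // -sqrtr_sqr.
by rewrite ler_sqrt ?(ltW xy0) // lerDl sqr_ge0.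
Qed.

Lemma weight_mono (R : realType) (x x' y : R) : 0 <= x -> x <= x' -> 0 < y ->
  weight x y <= weight x' y.
Proof.
move=> x0 xx' y0.
have pos z : 0 < z ^+ 2 + y ^+ 2 by rewrite ltr_wpDl ?sqr_ge0 ?exprn_gt0.
have x'0 : 0 <= x' by exact: le_trans xx'.
rewrite ler_pdivrMr ?sqrtr_gt0 // mulrAC ler_pdivlMr ?sqrtr_gt0 //.
rewrite -(@ler_pXn2r _ 2) ?nnegrE ?mulr_ge0 ?sqrtr_ge0 //.
rewrite !exprMn !sqr_sqrtr ?(ltW (pos _)) //.
rewrite !mulrDr [x' ^+ 2 * x ^+ 2]mulrC lerD2l ler_wpM2r ?sqr_ge0 //.
by rewrite ler_pXn2r.
Qed.

Lemma weight_ge (R : realType) (x y k : R) :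
  0 < x -> 0 <= y -> x <= k -> y <= k -> x / (2 * k) <= weight x y.
Proof.
move=> x0 y0 xk yk; have k0 : 0 < k by lra.
rewrite ler_pM2l // lef_pV2 ?posrE ?sqrtr_gt0 ?ltr_pwDl ?exprn_gt0 ?sqr_ge0 //; last lra.
rewrite -[leRHS]ger0_norm -?sqrtr_sqr; last lra.
rewrite ler_sqrt ?sqr_ge0 //; nra.
Qed.

(** Keeps only the multiples q, 2q, ..., qJ, whose sum is q J (J + 1) / 2. *)
Lemma sum_multiples_ge (q J : nat) : (0 < q)%N ->
  (q * J * J.+1 <= 2 * \sum_(m < q * J | q %| m.+1) m.+1)%N.
Proof.
move=> q0; elim: J => [|J IH]; first by rewrite muln0.
rewrite (mulnSr q J) big_mkcond big_split_ord /= -big_mkcond /=.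
have h : (q * J.+1 <= \sum_(i < q) if (q %| (q * J + i).+1) then (q * J + i).+1 else 0)%N.
  case: q q0 {IH} => // q _; rewrite big_ord_recr /= -addnS -mulnSr dvdn_mulr //.
  by rewrite leq_addl.
move: IH h; set S := (\sum_(_ < _ | _) _)%N; set T := (\sum_(_ < _) _)%N; nia.
Qed.

(** Two consecutive multiples of t cannot both be close to a zero of the sine:
    |sin t| = |sin ((k + 1) t - k t)| <= |sin (k t)| + |sin ((k + 1) t)|. *)
Lemma sum_norm_sin_ge (R : realType) (t : R) (L : nat) :
  L%:R * `|sin t| <= \sum_(n < 2 * L) `|sin (n.+1%:R * t)|.
Proof.
elim: L => [|L IH]; first by rewrite big_ord0 mul0r.
rewrite mulnS add2n !big_ord_recr /= -addrA -natr1 mulrDl mul1r lerD //.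
set k := (2 * L)%N.
have -> : sin t = sin (k.+2%:R * t) * cos (k.+1%:R * t) -
    cos (k.+2%:R * t) * sin (k.+1%:R * t).
  by rewrite -sinB; congr sin; rewrite -[k.+2%:R]natr1; ring.
rewrite (le_trans (ler_normB _ _)) // addrC !normrM lerD //.
  by rewrite ler_piMr // cos_max.
by rewrite ler_piMl // cos_max.
Qed.

(** * Cusps against cancellation *)

(** For a fixed n, the modes (m, n) that have been listed form an initial segment,
    on which summation by parts can be used. *)
Lemma down_closed_sum (R : realType) (P : pred nat) (B : nat) :
  (forall i j, (i <= j)%N -> P j -> P i) ->
  exists M, forall F : nat -> R, \sum_(i < B | P i) F i = \sum_(i < M) F i.
Proof.
move=> Pd; elim: B => [|B [M IH]].
  by exists 0%N => F; rewrite !big_ord0.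
have [PB|nPB] := boolP (P B).
  exists B.+1 => F; apply: eq_bigl => i; apply: (Pd _ B) => //.
  by rewrite -ltnS.
by exists M => F; rewrite big_mkcond big_ord_recr /= (negbTE nPB) addr0 -big_mkcond IH.
Qed.

(** The smooth modes of one row n = y cancel up to 2 q, whatever the length of the
    row. *)
Lemma slope_error_le (R : realType) (a y : R) (p q B : nat) (P : pred nat) :
  (0 < q)%N -> a * q%:R = p%:R -> 0 < y ->
  (forall i j, (i <= j)%N -> P j -> P i) ->
  `|\sum_(m < B | P m) weight m.+1%:R y * slope (m.+1%:R * pi * a)| <= 2 * q%:R.
Proof.
move=> q0 aq y0 Pd; have [M hM] := down_closed_sum R B Pd.
rewrite (hM (fun m => weight m.+1%:R y * slope (m.+1%:R * pi * a))).
apply: (le_trans (@abel_le R (fun m => weight m.+1%:R y)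
  (fun m => slope (m.+1%:R * pi * a)) q%:R M _ _ _)).
- by move=> i; apply: weight_ge0.
- by move=> i; apply: weight_mono => //; rewrite ler_nat.
- move=> k; apply: (@norm_periodic_sum_le R (fun m => slope (m.+1%:R * pi * a)) q k q0).
  + by move=> i; rewrite -(slope_period i.+1 aq) addSn.
  + by move=> i; apply: norm_slope_le1.
  + exact: sum_slope_period aq.
- by rewrite ler_piMr ?mulr_ge0 // weight_le1.
Qed.

(** In the square of side K, the cusps of a single row contribute about K / q:
    there are K / q of them, and their weights are m / (2 K) at least. *)
Lemma cusp_sum_ge (R : realType) (y : R) (q K : nat) :
  (0 < q)%N -> (0 < K)%N -> 0 <= y -> y <= K%:R ->
  (K %/ q)%:R / 4 <= \sum_(m < K | (q %| m.+1)%N) weight m.+1%:R y.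
Proof.
move=> q0 K0 y0 yK; set J := (K %/ q)%N.
have KR : 0 < K%:R :> R by rewrite ltr0n.
apply: (@le_trans _ _ (\sum_(m < K | (q %| m.+1)%N) m.+1%:R / (2 * K%:R))); last first.
  by apply: ler_sum => m _; apply: weight_ge => //; rewrite ler_nat.
rewrite -mulr_suml -natr_sum ler_pdivlMr; last lra.
have qJK : (q * J <= K)%N by rewrite mulnC leq_trunc_div.
have h1 : (\sum_(m < q * J | (q %| m.+1)%N) m.+1 <= \sum_(m < K | (q %| m.+1)%N) m.+1)%N.
  rewrite (big_ord_widen_cond _ (fun m => (q %| m.+1)%N) (fun m => m.+1) qJK).
  rewrite big_mkcond [leqRHS]big_mkcond; apply: leq_sum => m _ /=.
  by case: (q %| m.+1)%N => //=; case: ltnP.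
have h2 := sum_multiples_ge J q0.
have h3 : (K <= q * J.+1)%N by rewrite mulnC ltnW // ltn_ceil.
have : (J * K <= 2 * \sum_(m < K | (q %| m.+1)%N) m.+1)%N.
  move: h1 h2 h3; set S := (\sum_(_ < K | _) _)%N; set T := (\sum_(_ < _ | _) _)%N.
  nia.
rewrite -(@ler_nat R) !natrM; lra.
Qed.

(** The first-order balance: the cusps in the square of side K give
    K^2 s / (12 q), roughly, against an error 2 q for each of the 3 K rows.
    The predicate A tells which modes are present; its indices start from 0
    and stand for m + 1 and n + 1. *)
Lemma slope_sum_ge (R : realType) (a t s : R) (p q K : nat) (A : nat -> nat -> bool) :
  (0 < q)%N -> a * q%:R = p%:R -> (1 < K)%N -> 0 < s -> s <= `|sin t| ->
  (forall m m' n, (m' <= m)%N -> A m n -> A m' n) ->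
  (forall m n, (m < K)%N -> (n < K)%N -> A m n) ->
  K%:R * (s * (K %/ q)%:R / 12 - 6 * q%:R) <=
  \sum_(n < 3 * K) `|sin (n.+1%:R * t)| *
    (\sum_(m < 3 * K | A m n && (q %| m.+1)%N) weight m.+1%:R n.+1%:R
     - `|\sum_(m < 3 * K | A m n) weight m.+1%:R n.+1%:R * slope (m.+1%:R * pi * a)|).
Proof.
move=> q0 aq K1 s0 st Ad AK.
set c := fun n : nat =>
  \sum_(m < 3 * K | A m n && (q %| m.+1)%N) weight m.+1%:R n.+1%:R : R.
have K3 : (K <= 3 * K)%N by lia.
have c0 n : 0 <= c n by apply: sumr_ge0 => m _; apply: weight_ge0.
have cK n : (n < K)%N -> (K %/ q)%:R / 4 <= c n.
  move=> nK.
  apply: le_trans (_ : _ <= \sum_(m < K | (q %| m.+1)%N) weight m.+1%:R n.+1%:R) _.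
    by apply: cusp_sum_ge => //; rewrite ?ler_nat //; lia.
  rewrite (big_ord_widen_cond _ (fun m => (q %| m.+1)%N)
    (fun m => weight m.+1%:R n.+1%:R) K3).
  rewrite big_mkcond [leRHS]big_mkcond; apply: ler_sum => m _ /=.
  have [mK|_] := ltnP; last by rewrite andbF; case: ifP => // _; apply: weight_ge0.
  by rewrite AK // andbT.
pose J : R := (K %/ q)%:R / 4; have J0 : 0 <= J by rewrite divr_ge0.
apply: (@le_trans _ _ (\sum_(n < 3 * K)
    (`|sin (n.+1%:R * t)| * (if (n < K)%N then J else 0) - 2 * q%:R))); last first.
  apply: ler_sum => n _; rewrite mulrBr lerB //.
    by rewrite ler_wpM2l //; case: ifP => [/cK//|_]; exact: c0.
  rewrite (le_trans (ler_piMl _ (sin_max _))) //.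
  apply: (@slope_error_le R a n.+1%:R p q (3 * K) (fun m => A m n)) => //.
  by move=> i j; apply: Ad.
rewrite sumrB sumr_const card_ord.
have -> : \sum_(n < 3 * K) `|sin (n.+1%:R * t)| * (if (n < K)%N then J else 0)
   = (\sum_(n < K) `|sin (n.+1%:R * t)|) * J.
  rewrite (big_ord_widen _ (fun n => `|sin (n.+1%:R * t)|) K3) mulr_suml.
  rewrite [RHS]big_mkcond; apply: eq_bigr => n _; case: ifP => // _; exact: mulr0.
(* K./2 pairs of consecutive terms, and K./2 >= K / 3 because K >= 2 *)
have hS : K%:R / 3 * s <= \sum_(n < K) `|sin (n.+1%:R * t)|.
  have h2 : (2 * K./2 <= K)%N by lia.
  apply: (@le_trans _ _ (\sum_(n < 2 * K./2) `|sin (n.+1%:R * t)|)).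
    apply: le_trans (sum_norm_sin_ge t K./2).
    rewrite ler_pM //; rewrite ?(ltW s0) ?divr_ge0 //.
    rewrite ler_pdivrMr // -natrM ler_nat; lia.
  rewrite (big_ord_widen _ (fun n => `|sin (n.+1%:R * t)|) h2) big_mkcond.
  by apply: ler_sum => n _; case: ifP.
move: hS => /(ler_wpM2r J0); move: (\sum_(n < K) _) => S.
have -> : 2 * q%:R *+ (3 * K) = 6 * q%:R * K%:R :> R.
  by rewrite -mulr_natr natrM; ring.
rewrite /J; lra.
Qed.

(** Indices start from 0, so that (m, n) stands for the mode (m + 1, n + 1), as
    they do in [slope_sum_ge]. *)
Definition modal_sum {R : realType} (A : nat -> nat -> bool) (B : nat) (x y : R) : R :=
  \sum_(n < B) \sum_(m < B | A m n)
    (Num.sqrt (m.+1%:R ^+ 2 + n.+1%:R ^+ 2))^-1 *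
    (`|sin (m.+1%:R * pi * x)| * `|sin (n.+1%:R * pi * y)|).

Lemma sin_natpi (R : realType) (n : nat) : sin (n%:R * pi) = 0 :> R.
Proof.
by rewrite mulr_natl -[pi *+ n]add0r (alternatingn (@sinDpi R)) sin0 mulr0.
Qed.

(** One first-order lower bound for all modes. When q divides m, the point a is a
    zero of sin (m pi x): the slope is 0 there, and the cusp term takes over. *)
Lemma norm_sin_cusp_ge (R : realType) (a h : R) (p q m : nat) :
  a * q%:R = p%:R ->
  `|sin (m%:R * pi * a)| + slope (m%:R * pi * a) * (m%:R * pi * h)
    + (q %| m)%N%:R * `|m%:R * pi * h| - 2 * (m%:R * pi * h) ^+ 2
  <= `|sin (m%:R * pi * (a + h))|.
Proof.
move=> aq; rewrite (mulrDr _ a).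
have [/dvdnP[k mE]|_] := boolP (q %| m)%N; last first.
  rewrite mul0r addr0; exact: norm_sinD_ge.
have s0 : sin (m%:R * pi * a) = 0.
  rewrite mE -[RHS](sin_natpi R (k * p)); congr sin.
  by rewrite !natrM -aq; ring.
rewrite /slope s0 sgr0 !mul0r normr0 !add0r mul1r.
apply: le_trans (norm_sinD_ge0 _ s0).
by have := sqr_ge0 (m%:R * pi * h); lra.
Qed.

(** The first-order gain is pi c |h|, where c > 0 is the bound of [slope_sum_ge],
    positive because s (K / q) > 72 q. The remainder is at most C h^2. Neither c
    nor C depends on y, so the radius d does not either. *)
Lemma modal_sum_gt (R : realType) (a s : R) (p q K : nat) (A : nat -> nat -> bool) :
  (0 < q)%N -> a * q%:R = p%:R -> (1 < K)%N -> 0 < s ->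
  72 * q%:R < s * (K %/ q)%:R ->
  (forall m m' n, (m' <= m)%N -> A m n -> A m' n) ->
  (forall m n, (m < K)%N -> (n < K)%N -> A m n) ->
  exists2 d, 0 < d & forall h y : R, h != 0 -> `|h| < d -> s <= `|sin (pi * y)| ->
    modal_sum A (3 * K) a y < modal_sum A (3 * K) (a + h) y.
Proof.
move=> q0 aq K1 s0 sJ Ad AK.
set c := K%:R * (s * (K %/ q)%:R / 12 - 6 * q%:R).
have c0 : 0 < c by rewrite mulr_gt0 ?ltr0n ?(ltnW K1) //; lra.
set B := (3 * K)%N.
set C : R := \sum_(n < B) \sum_(m < B | A m n) 2 * (m.+1%:R * pi) ^+ 2.
have C0 : 0 <= C.
  by apply: sumr_ge0 => n _; apply: sumr_ge0 => m _; rewrite mulr_ge0 ?sqr_ge0.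
have C1 : 0 < C + 1 by rewrite ltr_wpDl.
exists (pi * c / (C + 1)); first exact: divr_gt0 (mulr_gt0 (pi_gt0 R) c0) C1.
move=> h y h0 hd sy; rewrite -subr_gt0 /modal_sum -sumrB.
have hd' : `|h| * C < pi * c.
  move: hd; rewrite ltr_pdivlMr //.
  by apply: le_lt_trans; rewrite ler_wpM2l // lerDl.
have hp : 0 < `|h| by rewrite normr_gt0.
apply: (@lt_le_trans _ _ (pi * `|h| * c - C * h ^+ 2)).
  rewrite subr_gt0 -(real_normK (num_real h)).
  have : `|h| * (`|h| * C) < `|h| * (pi * c) by rewrite ltr_pM2l.
  by rewrite expr2; lra.
have := slope_sum_ge q0 aq K1 s0 sy Ad AK; rewrite -/c -/B => hc.
apply: (@le_trans _ _ (pi * `|h| * (\sum_(n < B) `|sin (n.+1%:R * (pi * y))| *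
    (\sum_(m < B | A m n && (q %| m.+1)%N) weight m.+1%:R n.+1%:R -
     `|\sum_(m < B | A m n) weight m.+1%:R n.+1%:R * slope (m.+1%:R * pi * a)|))
     - C * h ^+ 2)).
  by rewrite lerD2r ler_wpM2l // mulr_ge0 ?pi_ge0.
rewrite /C mulr_sumr mulr_suml -sumrB; apply: ler_sum => n _.
set v : R := `|sin (n.+1%:R * (pi * y))|.
apply: (@le_trans _ _ (v *
    (pi * h * (\sum_(m < B | A m n)
        weight m.+1%:R n.+1%:R * slope (m.+1%:R * pi * a)) +
     pi * `|h| * (\sum_(m < B | A m n && (q %| m.+1)%N) weight m.+1%:R n.+1%:R))
  - (\sum_(m < B | A m n) 2 * (m.+1%:R * pi) ^+ 2) * h ^+ 2)).
  rewrite lerD2r mulrCA ler_wpM2l //; first exact: normr_ge0.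
  set E := \sum_(m < B | A m n) _; set c' := \sum_(m < B | _ && _) _.
  have : - (pi * `|h| * `|E|) <= pi * h * E.
    rewrite -!mulrA -mulrN ler_wpM2l ?pi_ge0 // -normrM lerNl.
    by rewrite -normrN ler_norm.
  lra.
rewrite big_mkcondr /= -sumrB mulrDr !mulr_sumr mulr_suml -big_split -sumrB /=.
apply: ler_sum => m _.
have := norm_sin_cusp_ge h m.+1 aq.
set r := (Num.sqrt _)^-1.
have -> : weight m.+1%:R n.+1%:R = m.+1%:R * r :> R by [].
have r0 : 0 <= r by rewrite invr_ge0.
have r1 : r <= 1.
  rewrite invf_le1; last first.
    by rewrite sqrtr_gt0 ltr_wpDl ?sqr_ge0 ?exprn_gt0.
  rewrite -[leLHS]sqrtr1 ler_sqrt ?addr_ge0 ?sqr_ge0 //.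
  by rewrite ler_wpDr ?sqr_ge0 // exprn_ege1 // ler1n.
have v0 : 0 <= v by exact: normr_ge0.
have v1 : v <= 1 by exact: sin_max.
rewrite -[n.+1%:R * pi * y]mulrA -/v.
have -> : `|m.+1%:R * pi * h| = m.+1%:R * pi * `|h|.
  by rewrite normrM ger0_norm // mulr_ge0 ?pi_ge0.
have -> : (if (q %| m.+1)%N then m.+1%:R * r else 0) =
    (q %| m.+1)%N%:R * (m.+1%:R * r) by case: ifP; rewrite ?mul1r ?mul0r.
move: (slope _) `|sin (_ * a)| `|sin (_ * (a + h))| (_ %| _)%N%:R => g u0 u b.
have rv0 : 0 <= r * v by exact: mulr_ge0.
have rv1 : r * v <= 1 by exact: mulr_ile1.
move=> /(ler_wpM2l rv0).
have := ler_wpM2r (sqr_ge0 (m.+1%:R * pi * h)) rv1.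
move: pi (m.+1%:R) => P M; rewrite !expr2; lra.
Qed.

(** * Eigenvalues and norms of the modes *)

Lemma is_derive_mull (R : realType) (f : R -> R) (k t df : R) :
  is_derive t 1 f df -> is_derive t 1 (fun t : R => k * f t) (k * df).
Proof. exact: is_deriveZ. Qed.

Lemma is_derive_scale (R : realType) (c t : R) :
  is_derive t 1 (fun t : R => c * t) c.
Proof. by rewrite -[X in is_derive _ _ _ X]mulr1; apply: is_derive_mull. Qed.

(** The difference quotient of f(x) g(y) in the direction (1, 0) at (x, y) is that
    of g(y) f at x. *)
Lemma derive_fst_mul (R : realType) (f f' g : R -> R) :
  (forall t : R, is_derive t 1 f (f' t)) ->
  'D_((1, 0) : R * R) (fun w : R * R => f w.1 * g w.2) =
  (fun w : R * R => f' w.1 * g w.2).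
Proof.
move=> fE; apply/funext => z.
rewrite [RHS]mulrC -(@derive_val _ _ _ _ _ _ _ (is_derive_mull (g z.2) (fE z.1))).
rewrite /derive; apply: (congr1 (fun F : R -> R => lim (F @ 0^'))); apply/funext => h /=.
by rewrite scaler0 add0r ![g z.2 * _]mulrC.
Qed.

Lemma derive_snd_mul (R : realType) (f g g' : R -> R) :
  (forall t : R, is_derive t 1 g (g' t)) ->
  'D_((0, 1) : R * R) (fun w : R * R => f w.1 * g w.2) =
  (fun w : R * R => f w.1 * g' w.2).
Proof.
move=> gE; apply/funext => z.
rewrite -(@derive_val _ _ _ _ _ _ _ (is_derive_mull (f z.1) (gE z.2))).
rewrite /derive; apply: (congr1 (fun F : R -> R => lim (F @ 0^'))); apply/funext => h /=.
by rewrite scaler0 add0r.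
Qed.

Lemma is_derive_sin_scale (R : realType) (c t : R) :
  is_derive t 1 (fun t : R => sin (c * t)) (c * cos (c * t)).
Proof.
rewrite mulrC.
exact: (@is_derive1_comp R sin (fun t => c * t) _ _ _ _ (is_derive_scale c t)).
Qed.

Lemma is_derive_cos_scale (R : realType) (c t : R) :
  is_derive t 1 (fun t : R => c * cos (c * t)) (- c ^+ 2 * sin (c * t)).
Proof.
rewrite (_ : - _ * _ = c * (- sin (c * t) * c)); last by ring.
apply: is_derive_mull.
exact: (@is_derive1_comp R cos (fun t => c * t) _ _ _ _ (is_derive_scale c t)).
Qed.

Lemma laplacian_mode (R : realType) (mn : nat * nat) (z : R * R) :
  laplacian (mode mn) z =
  - (pi ^+ 2 * (mn.1%:R ^+ 2 + mn.2%:R ^+ 2)) * mode mn z.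
Proof.
case: mn => m n; rewrite /laplacian /mode /=.
set a : R := m%:R * pi; set b : R := n%:R * pi.
have := derive_fst_mul (fun t => sin (b * t)) (is_derive_sin_scale a).
have := derive_fst_mul (fun t => sin (b * t)) (is_derive_cos_scale a).
have := derive_snd_mul (fun t => sin (a * t)) (is_derive_sin_scale b).
have := derive_snd_mul (fun t => sin (a * t)) (is_derive_cos_scale b).
move=> /= yy y xx x; rewrite x y.
move: (congr1 (@^~ z) xx) (congr1 (@^~ z) yy) => /= -> ->.
by rewrite /a /b; move: pi => P; ring.
Qed.

(** The first maximum of sin (m pi x), where it equals 1. *)
Definition peak {R : realType} (m : nat) : R := (2 * m%:R)^-1.

Lemma sin_peak (R : realType) (m : nat) : (0 < m)%N ->
  sin (m%:R * pi * peak m) = 1 :> R.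
Proof.
move=> m0; rewrite -[RHS]sin_pihalf; congr sin; rewrite /peak.
have : m%:R != 0 :> R by rewrite pnatr_eq0 -lt0n.
by move: pi => P ?; field.
Qed.

Lemma peak_itv (R : realType) (m : nat) : (0 < m)%N -> (peak m : R) \in `]0, 1[.
Proof.
move=> m0; have m1 : 1 <= m%:R :> R by rewrite ler1n.
rewrite in_itv /= /peak invr_gt0 invf_lt1; lra.
Qed.

Lemma open_interior_unit_square (R : realType) (z : R * R) :
  z.1 \in `]0, 1[ -> z.2 \in `]0, 1[ -> unit_square° z.
Proof.
move=> z1 z2; exists (`]0, 1[%classic, `]0, 1[%classic) => /=.
  by split; apply: open_nbhs_nbhs; split => //; apply: interval_open.
by move=> w [/= w1 w2]; split; exact: subset_itv_oo_cc.
Qed.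

Lemma mode_peak (R : realType) (m n : nat) : (0 < m)%N -> (0 < n)%N ->
  mode (m, n) (peak m, peak n) = 1 :> R.
Proof. by move=> m0 n0; rewrite /mode /= !sin_peak // mulr1. Qed.

(** The eigenvalue is determined by evaluating the eigenvalue equation at an
    interior point where the mode equals 1. *)
Lemma mode_eigenvalue (R : realType) (mn : nat * nat) (l : R) :
  (0 < mn.1)%N -> (0 < mn.2)%N -> dirichlet_eigenpair l (mode mn) ->
  l = pi ^+ 2 * (mn.1%:R ^+ 2 + mn.2%:R ^+ 2).
Proof.
case: mn => m n /= m0 n0 [_ _ _ /(_ (peak m, peak n))].
case; first by apply: open_interior_unit_square; exact: peak_itv.
by move=> _; rewrite laplacian_mode mode_peak // !mulr1 opprK.
Qed.

Lemma continuous_mode (R : realType) (mn : nat * nat) :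
  continuous (mode mn : R * R -> R).
Proof.
have sinc (k : R) (g : R * R -> R) : continuous g ->
    continuous (fun z => sin (k * g z)).
  move=> gc z; apply: (@continuous_comp _ _ _ (fun z => k * g z) sin).
    by apply: continuousM; [exact: cst_continuous|exact: gc].
  exact: continuous_sin.
move=> z; apply: (@continuousM R _ (fun z : R * R => sin (mn.1%:R * pi * z.1))
  (fun z : R * R => sin (mn.2%:R * pi * z.2))); apply: sinc => w.
  exact: cvg_fst.
exact: cvg_snd.
Qed.

Lemma negligible_setX (d1 d2 : measure_display) (T1 : measurableType d1)
    (T2 : measurableType d2) (R : realType) (m1 : {measure set T1 -> \bar R})
    (m2 : {sigma_finite_measure set T2 -> \bar R}) (A : set T1) (B : set T2) :
  measurable A -> measurable B -> (m1 \x m2)%E.-negligible (A `*` B) ->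
  (m1 A * m2 B = 0)%E.
Proof.
move=> mA mB /(measure_negligible (measurableX mA mB)).
by rewrite /= product_measure1E.
Qed.

Lemma nbhs_not_negligible (R : realType) (z : R * R) (A : set (R * R)) :
  nbhs z A ->
  ~ (@lebesgue_measure R \x @lebesgue_measure R)%E.-negligible A.
Proof.
case: z => x y [[U V] /= [/nbhs_ballP[e /= e0 eU] /nbhs_ballP[d /= d0 dV] UVA]] nA.
have nX : (@lebesgue_measure R \x @lebesgue_measure R)%E.-negligible
    (ball x e `*` ball y d).
  apply: negligibleS nA => -[u v] [/= /eU Uu /dV Vv]; exact: (UVA (u, v)).
have : (@lebesgue_measure R (ball x e) * @lebesgue_measure R (ball y d) = 0)%E.
  by apply: negligible_setX nX; rewrite ball_itv; exact: measurable_itv.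
rewrite !lebesgue_measure_ball ?ltW //.
rewrite -EFinM => -[] /eqP; rewrite mulf_eq0 => /orP[]; rewrite mulrn_eq0 /= => /eqP h.
  by rewrite h ltxx in e0.
by rewrite h ltxx in d0.
Qed.

(** A continuous function exceeds any number below its maximum on a neighbourhood
    of the point where the maximum is reached, and a neighbourhood is not
    negligible. *)
Lemma Linfty_norm_mode (R : realType) (m n : nat) : (0 < m)%N -> (0 < n)%N ->
  Linfty_norm (mode (m, n) : R * R -> R) = 1.
Proof.
move=> m0 n0; rewrite /Linfty_norm unlock /=.
set mu := (_ \x _)%E; set f := (abse \o _).
have f1 z : (f z <= 1)%E.
  rewrite /f /= lee_fin /patch; case: ifP => _; last by rewrite normr0.
  by rewrite normrM mulr_ile1 ?sin_max.
have fE z : unit_square z -> f z = `|mode (m, n) z|%:E.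
  by move=> Dz; rewrite /f /= /patch mem_set.
have mu0 : (0 < mu setT)%E.
  rewrite lt0e measure_ge0 andbT; apply/eqP => mu0.
  by apply: (@nbhs_not_negligible R (0, 0) setT filterT); apply/negligibleP.
rewrite mu0 (_ : ess_sup mu f = 1%E) //.
apply/eqP; rewrite eq_le; apply/andP; split.
  by apply/ess_supP; exact: nearW.
rewrite leNgt; apply/negP => lt1.
have [r /andP[fr r1]] : exists r : R, (ess_sup mu f <= r%:E)%E && (r < 1).
  case: (ess_sup mu f) lt1 => [r||] // h.
    by exists r; rewrite lexx.
  by exists 0; rewrite leNye ltr01.
apply: (@nbhs_not_negligible R (peak m, peak n)
  (~` [set z | (f z <= r%:E)%E])); last first.
  by move/ess_supP: fr.
have pD : \forall z \near ((peak m, peak n) : R * R), unit_square z.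
  by apply: open_interior_unit_square; exact: peak_itv.
have pr : \forall z \near ((peak m, peak n) : R * R), r < mode (m, n) z.
  have c := @continuous_mode R (m, n) (peak m, peak n).
  have h : r < mode (m, n) (peak m, peak n) by rewrite mode_peak.
  exact: cvgr_gt c _ h.
near=> z => /=; rewrite fE; last by near: z.
apply/negP; rewrite -ltNge lte_fin; apply: lt_le_trans (ler_norm _).
by near: z.
Unshelve. all: by end_near. Qed.

(** * The shape of the set of listed modes *)

Definition sqnorm (p : nat * nat) : nat := (p.1 ^ 2 + p.2 ^ 2)%N.

(** What the proof uses of the order of the eigenvalues. It does not refer to the
    order inside an eigenspace, and it is invariant under the exchange of the
    two coordinates. *)
Definition increasing_enumeration (mn : nat -> nat * nat) : Prop :=
  [/\ forall k, (0 < k)%N -> (0 < (mn k).1)%N && (0 < (mn k).2)%N,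
      forall j k, (0 < j)%N -> (0 < k)%N -> mn j = mn k -> j = k,
      forall m n, (0 < m)%N -> (0 < n)%N -> exists2 k, (0 < k)%N & mn k = (m, n) &
      forall j k, (0 < j)%N -> (j <= k)%N -> (sqnorm (mn j) <= sqnorm (mn k))%N].

Definition swap_pair (p : nat * nat) : nat * nat := (p.2, p.1).

Lemma increasing_enumeration_swap (mn : nat -> nat * nat) :
  increasing_enumeration mn -> increasing_enumeration (swap_pair \o mn).
Proof.
move=> [pos inj surj mono]; split => /=.
- by move=> k /pos; rewrite andbC.
- move=> j k j0 k0 [e2 e1]; apply: inj => //.
  by rewrite (surjective_pairing (mn j)) e1 e2 -surjective_pairing.
- by move=> m n m0 n0; have [k k0 e] := surj n m n0 m0; exists k; rewrite // /= e.
- by move=> j k j0 jk; rewrite /sqnorm addnC [leqRHS]addnC; exact: mono.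
Qed.

Definition first_modes (mn : nat -> nat * nat) (N : nat) : seq (nat * nat) :=
  [seq mn k | k <- index_iota 1 N.+1].

Lemma mem_first_modes (mn : nat -> nat * nat) (N : nat) (p : nat * nat) :
  reflect (exists2 k, (0 < k <= N)%N & mn k = p) (p \in first_modes mn N).
Proof.
apply: (iffP mapP) => [[k]|[k kN <-]].
  by rewrite mem_index_iota ltnS => kN ->; exists k.
by exists k; rewrite // mem_index_iota ltnS.
Qed.

(** For a fixed n the eigenvalue is strictly increasing in m, so a mode is always
    listed after the modes with the same n and a smaller m, ties or not. *)
Lemma first_modes_down (mn : nat -> nat * nat) (N m m' n : nat) :
  increasing_enumeration mn -> (0 < m' <= m)%N ->
  (m, n) \in first_modes mn N -> (m', n) \in first_modes mn N.
Proof.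
move=> [pos inj surj mono] /andP[m'0 m'm] /mem_first_modes[k /andP[k0 kN] mnk].
have n0 : (0 < n)%N by have := pos k k0; rewrite mnk => /andP[].
have [j j0 mnj] := surj m' n m'0 n0; apply/mem_first_modes; exists j => //.
rewrite j0 /=; apply: leq_trans kN; rewrite leqNgt; apply/negP => kj.
have := mono k j k0 (ltnW kj); rewrite mnj mnk /sqnorm /= => h.
have mm : m = m' by move: h m'm; nia.
by move: kj; rewrite (inj j k) ?ltnn // mnj mnk mm.
Qed.

(** Let T be the value of m^2 + n^2 at the N-th mode. All listed modes lie in the
    disc of radius sqrt T, and all modes in its interior are listed. With K the
    largest integer such that 2 K^2 < T, the square of side K is listed
    entirely, and T <= 2 (K + 1)^2 <= 9 K^2 puts the disc in the square of
    side 3 K. *)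
Lemma first_modes_square (mn : nat -> nat * nat) (L : nat) :
  increasing_enumeration mn -> (0 < L)%N ->
  exists N0, forall N, (N0 <= N)%N -> exists2 K, (L <= K)%N &
    (forall p, p \in first_modes mn N -> (p.1 <= 3 * K)%N && (p.2 <= 3 * K)%N) /\
    (forall m n, (0 < m <= K)%N -> (0 < n <= K)%N -> (m, n) \in first_modes mn N).
Proof.
move=> [pos inj surj mono] L0.
(* any mode outside the disc of radius sqrt 2 L serves as the starting point *)
have [N0 N00 mnN0] := surj (2 * L)%N 1%N (ltac:(lia)) isT.
exists N0 => N N0N; have N1 : (0 < N)%N by lia.
set T := sqnorm (mn N).
have LT : (2 * L ^ 2 < T)%N.
  by have := mono _ _ N00 N0N; rewrite mnN0 /sqnorm -/T /= -/(sqnorm _); nia.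
have exK : exists K, (2 * K ^ 2 < T)%N by exists L.
have bK K : (2 * K ^ 2 < T)%N -> (K <= T)%N by nia.
case: (ex_maxnP exK bK) => K KT maxK.
have LK : (L <= K)%N by exact: maxK.
have TK : (T <= 2 * K.+1 ^ 2)%N.
  by rewrite leqNgt; apply/negP => /maxK; rewrite ltnn.
exists K => //; split.
- move=> p /mem_first_modes[k /andP[k0 kN] mnk].
  have := mono _ _ k0 kN; rewrite mnk -/T /sqnorm; case: p {mnk} => m n /= h.
  have : (m ^ 2 + n ^ 2 <= 9 * K ^ 2)%N by move: TK h; nia.
  by move=> h2; apply/andP; split; nia.
- move=> m n /andP[m0 mK] /andP[n0 nK].
  have [k k0 mnk] := surj m n m0 n0; apply/mem_first_modes; exists k => //.
  rewrite k0 leqNgt; apply/negP => Nk.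
  have := mono _ _ N1 (ltnW Nk); rewrite mnk -/T /sqnorm /=; nia.
Qed.

Definition mode_term {R : realType} (x y : R) (p : nat * nat) : R :=
  (Num.sqrt (p.1%:R ^+ 2 + p.2%:R ^+ 2))^-1 *
  (`|sin (p.1%:R * pi * x)| * `|sin (p.2%:R * pi * y)|).

(** The list of modes is arranged in rows of constant n, where the cancellation
    takes place. *)
Lemma sum_first_modes (R : realType) (mn : nat -> nat * nat) (N B : nat) (x y : R) :
  increasing_enumeration mn ->
  (forall p, p \in first_modes mn N -> (p.1 <= B)%N && (p.2 <= B)%N) ->
  \sum_(p <- first_modes mn N) mode_term x y p =
  modal_sum (fun m n => (m.+1, n.+1) \in first_modes mn N) B x y.
Proof.
move=> [pos inj surj mono] sB; rewrite /modal_sum pair_big_dep /=.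
set c := fun p : 'I_B * 'I_B => (p.2.+1, p.1.+1).
transitivity (\sum_(p : 'I_B * 'I_B | c p \in first_modes mn N) mode_term x y (c p)) => //.
rewrite -[RHS]big_filter -[RHS](big_map c xpredT (mode_term x y)); apply: perm_big.
apply: uniq_perm.
- rewrite map_inj_in_uniq ?iota_uniq // => j k.
  by rewrite !mem_index_iota => /andP[j0 _] /andP[k0 _]; exact: inj.
- rewrite map_inj_uniq ?filter_uniq ?index_enum_uniq //.
  by move=> [n m] [n' m'] [e1 e2]; congr pair; apply: val_inj.
- move=> p; apply/idP/mapP => [ps|[q]]; last first.
    by rewrite mem_filter => /andP[+ _] ->.
  have /andP[pB1 pB2] := sB p ps.
  have /mem_first_modes[k /andP[/pos + _] e] := ps; rewrite e => /andP[p1 p2].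
  have h1 : (p.1.-1 < B)%N by rewrite prednK.
  have h2 : (p.2.-1 < B)%N by rewrite prednK.
  have pE : p = c (Ordinal h2, Ordinal h1).
    by rewrite /c /= !prednK // -surjective_pairing.
  by exists (Ordinal h2, Ordinal h1); rewrite // mem_filter -pE ps mem_index_enum.
Qed.

Lemma first_modes_sum_gt (R : realType) (mn : nat -> nat * nat) (a s : R) (p q : nat) :
  increasing_enumeration mn -> (0 < q)%N -> a * q%:R = p%:R -> 0 < s ->
  exists N0, forall N, (N0 <= N)%N ->
  exists2 d : R, 0 < d & forall h y, h != 0 -> `|h| < d -> s <= `|sin (pi * y)| ->
    \sum_(p <- first_modes mn N) mode_term a y p <
    \sum_(p <- first_modes mn N) mode_term (a + h) y p.
Proof.
move=> mnE q0 aq s0.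
set J := Num.bound (72 * q%:R / s).
have hJ : 72 * q%:R < s * J%:R.
  rewrite [s * _]mulrC -ltr_pdivrMr // archi_boundP // divr_ge0 ?mulr_ge0 //.
  exact: ltW.
(* a side K >= q J gives K / q >= J, which is what the cusps need to win *)
have L0 : (0 < q * J + 2)%N by lia.
have [N0 N0P] := first_modes_square mnE L0.
exists N0 => N /N0P[K LK [sB sK]].
have [||||d d0 dP] := @modal_sum_gt R a s p q K
    (fun m n => (m.+1, n.+1) \in first_modes mn N) q0 aq _ s0.
- by lia.
- apply: lt_le_trans hJ _; rewrite ler_pM2l // ler_nat leq_divRL //; lia.
- move=> m m' n m'm; apply: first_modes_down => //.
- by move=> m n mK nK; apply: sK.
exists d => // h y h0 hd sy.
by rewrite !(sum_first_modes _ _ mnE sB); exact: dP.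
Qed.

(** * Increments of the sum near a rational point *)

Lemma mode_term_swap (R : realType) (x y : R) (p : nat * nat) :
  mode_term x y (swap_pair p) = mode_term y x p.
Proof. by rewrite /mode_term /= addrC [X in _ * X]mulrC. Qed.

Lemma sum_first_modes_swap (R : realType) (mn : nat -> nat * nat) (N : nat) (x y : R) :
  \sum_(p <- first_modes (swap_pair \o mn) N) mode_term x y p =
  \sum_(p <- first_modes mn N) mode_term y x p.
Proof. by rewrite !big_map; apply: eq_bigr => k _; rewrite mode_term_swap. Qed.

Lemma ratr_fraction (R : realType) (a : rat) : 0 < a ->
  exists p q : nat, (0 < q)%N /\ ratr a * q%:R = p%:R :> R.
Proof.
move=> a0; exists `|numq a|%N, `|denq a|%N; split; first by rewrite absz_gt0 denq_neq0.
have dE : (`|denq a|%N)%:R = (denq a)%:~R :> R.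
  by rewrite -[in RHS](gez0_abs (denq_ge0 a)).
have nE : (`|numq a|%N)%:R = (numq a)%:~R :> R.
  by rewrite -[in RHS](@gez0_abs (numq a)) // numq_ge0 ltW.
by rewrite dE nE /ratr mulfVK // intr_eq0 denq_neq0.
Qed.

Lemma sin_pi_lower_bound (R : realType) (y0 : R) : 0 < y0 < 1 ->
  exists2 s : R, 0 < s & exists2 d : R, 0 < d &
    forall y, `|y - y0| < d -> s <= `|sin (pi * y)|.
Proof.
move=> /andP[y00 y01].
have s0 : 0 < sin (pi * y0).
  apply: sin_gt0_pi; rewrite mulr_gt0 ?pi_gt0 //=.
  by rewrite -[ltRHS]mulr1 ltr_pM2l // pi_gt0.
exists (sin (pi * y0) / 2); first by rewrite divr_gt0.
have c : {for y0, continuous (fun y : R => sin (pi * y))}.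
  apply: continuous_comp; last exact: continuous_sin.
  by apply: continuousM; [exact: cst_continuous|exact: cvg_id].
have h : sin (pi * y0) / 2 < sin (pi * y0) by rewrite ltr_pdivrMr // ltr_pMr // ltr1n.
have nb : \forall y \near y0, sin (pi * y0) / 2 < sin (pi * y).
  exact: cvgr_gt c _ h.
have /nbhs_ballP[d /= d0 dP] := nb.
exists d => // y yd; apply: le_trans (ler_norm _); apply/ltW/dP.
by rewrite /ball /= distrC.
Qed.

(** The radius d serves for all y near y0 and not only for y0: the
    two-variable statement needs this. *)
Lemma first_modes_sum_gt_fst (R : realType) (mn : nat -> nat * nat) (a : rat) (y0 : R) :
  increasing_enumeration mn -> 0 < a -> 0 < y0 < 1 ->
  exists N0, forall N, (N0 <= N)%N ->
  exists2 d : R, 0 < d & forall x y, x != ratr a -> `|x - ratr a| < d -> `|y - y0| < d ->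
    \sum_(p <- first_modes mn N) mode_term (ratr a) y p <
    \sum_(p <- first_modes mn N) mode_term x y p.
Proof.
move=> mnE a0 y01; have [p [q [q0 aq]]] := ratr_fraction R a0.
have [s s0 [d d0 dP]] := sin_pi_lower_bound y01.
have [N0 N0P] := first_modes_sum_gt mnE q0 aq s0.
exists N0 => N /N0P[e e0 eP]; exists (Num.min d e); first by rewrite lt_min d0.
move=> x y xa; rewrite !lt_min => /andP[_ xe] /andP[yd _].
rewrite -[x in ltRHS](subrKC (ratr a)).
by apply: eP; rewrite ?subr_eq0 //; exact: dP.
Qed.

Lemma first_modes_sum_gt_snd (R : realType) (mn : nat -> nat * nat) (b : rat) (x0 : R) :
  increasing_enumeration mn -> 0 < b -> 0 < x0 < 1 ->
  exists N0, forall N, (N0 <= N)%N ->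
  exists2 d : R, 0 < d & forall x y, y != ratr b -> `|y - ratr b| < d -> `|x - x0| < d ->
    \sum_(p <- first_modes mn N) mode_term x (ratr b) p <
    \sum_(p <- first_modes mn N) mode_term x y p.
Proof.
move=> /increasing_enumeration_swap mnE b0 x01.
have [N0 N0P] := first_modes_sum_gt_fst mnE b0 x01.
exists N0 => N /N0P[d d0 dP]; exists d => // x y yb yd xd.
by rewrite -[ltLHS]sum_first_modes_swap -[ltRHS]sum_first_modes_swap; exact: dP.
Qed.

(** * The minimizers *)

Lemma mode_enumeration (R : realType) (mn : nat -> nat * nat) (lam : nat -> R)
    (phi : nat -> R * R -> R) :
  set_bij [set k : nat | (1 <= k)%N]
    [set p : nat * nat | (1 <= p.1)%N /\ (1 <= p.2)%N] mn ->
  (forall k : nat, (1 <= k)%N -> phi k = mode (mn k)) ->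
  (forall k : nat, (1 <= k)%N -> dirichlet_eigenpair (lam k) (phi k)) ->
  (forall j k : nat, (1 <= j)%N -> (j <= k)%N -> lam j <= lam k) ->
  increasing_enumeration mn /\
  forall N x y, fN lam phi N (x, y) =
    pi^-1 * \sum_(p <- first_modes mn N) mode_term x y p.
Proof.
move=> [mnf mni mns] phiE lamE lamle.
have pos k : (0 < k)%N -> (0 < (mn k).1)%N && (0 < (mn k).2)%N.
  by move=> /mnf[-> ->].
have lamS k : (0 < k)%N ->
    lam k = pi ^+ 2 * ((mn k).1%:R ^+ 2 + (mn k).2%:R ^+ 2).
  move=> k0; have /andP[p1 p2] := pos k k0.
  by apply: mode_eigenvalue => //; rewrite -phiE //; exact: lamE.
split.
  split=> //.
  - by move=> j k j0 k0; apply: mni; rewrite inE.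
  - by move=> m n m0 n0; have [k k0 e] := mns (m, n) (conj m0 n0); exists k.
  - move=> j k j0 jk; have := lamle _ _ j0 jk.
    rewrite !lamS ?(leq_trans j0) // ler_pM2l ?exprn_gt0 ?pi_gt0 //.
    by rewrite -!natrX -!natrD ler_nat.
move=> N x y; rewrite /fN big_map mulr_sumr !big_nat; apply: eq_bigr => k /andP[k0 _].
have /andP[p1 p2] := pos k k0.
rewrite phiE // [mn k]surjective_pairing Linfty_norm_mode // divr1 lamS //.
rewrite sqrtrM ?sqr_ge0 // sqrtr_sqr ger0_norm ?pi_ge0 // invfM /mode_term /mode /= normrM.
by rewrite -[LHS]mulrA.
Qed.

Unset Implicit Arguments.

Theorem theorem1 (R : realType) (mn : nat -> nat * nat) (lam : nat -> R)
    (phi : nat -> R * R -> R)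
    (mn_bij : set_bij [set k : nat | (1 <= k)%N]
                [set p : nat * nat | (1 <= p.1)%N /\ (1 <= p.2)%N] mn)
    (phiE : forall k : nat, (1 <= k)%N -> phi k = mode (mn k))
    (lam_eigen : forall k : nat, (1 <= k)%N ->
                   dirichlet_eigenpair (lam k) (phi k))
    (lam_nondecreasing : forall j k : nat, (1 <= j)%N -> (j <= k)%N ->
                           lam j <= lam k) :
  [/\ forall (y : R) (a : rat), 0 < y < 1 -> 0 < a < 1 ->
        exists N0 : nat, forall N : nat, (N0 <= N)%N ->
          local_minimizer (`[0, 1] : set R) (fun x : R => fN lam phi N (x, y)) (ratr a),
      forall (x : R) (b : rat), 0 < x < 1 -> 0 < b < 1 ->
        exists N0 : nat, forall N : nat, (N0 <= N)%N ->
          local_minimizer (`[0, 1] : set R) (fun y : R => fN lam phi N (x, y)) (ratr b) &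
      forall a b : rat, 0 < a < 1 -> 0 < b < 1 ->
        exists N0 : nat, forall N : nat, (N0 <= N)%N ->
          strict_local_minimizer unit_square (fN lam phi N) (ratr a, ratr b)].
Proof.
have [mnE fNE] := mode_enumeration mn_bij phiE lam_eigen lam_nondecreasing.
have pi0 : 0 < pi^-1 :> R by rewrite invr_gt0 pi_gt0.
have ratr01 (c : rat) : 0 < c < 1 -> 0 < (ratr c : R) < 1.
  by case/andP => c0 c1; rewrite ltr0q c0 /= -(rmorph1 (@ratr R)) ltr_rat.
have in01 (c : R) : 0 < c < 1 -> `[0, 1]%classic c.
  by rewrite /= in_itv /= => /andP[/ltW -> /ltW ->].
split.
- move=> y a y01 a01; have /andP[a0 _] := a01.
  have [N0 N0P] := first_modes_sum_gt_fst mnE a0 y01.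
  exists N0 => N /N0P[d d0 dP]; split; first exact/in01/ratr01.
  apply/nbhs_ballP; exists d => //= x; rewrite /ball /= distrC => xd _.
  have [->//|xa] := eqVneq x (ratr a).
  by rewrite !fNE ler_pM2l // ltW // dP // subrr normr0.
- move=> x b x01 b01; have /andP[b0 _] := b01.
  have [N0 N0P] := first_modes_sum_gt_snd mnE b0 x01.
  exists N0 => N /N0P[d d0 dP]; split; first exact/in01/ratr01.
  apply/nbhs_ballP; exists d => //= y; rewrite /ball /= distrC => yd _.
  have [->//|yb] := eqVneq y (ratr b).
  by rewrite !fNE ler_pM2l // ltW // dP // subrr normr0.
- move=> a b a01 b01; have /andP[a0 _] := a01; have /andP[b0 _] := b01.
  have [N1 N1P] := first_modes_sum_gt_fst mnE a0 (ratr01 _ b01).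
  have [N2 N2P] := first_modes_sum_gt_snd mnE b0 (ratr01 _ a01).
  exists (maxn N1 N2) => N; rewrite geq_max => /andP[/N1P[d d0 dP] /N2P[e e0 eP]].
  split; first by split; exact/in01/ratr01.
  apply/nbhs_ballP; exists (Num.min d e); first by rewrite /= lt_min d0.
  move=> [x y] [] /=; rewrite /ball /= !lt_min ![`|ratr _ - _|]distrC.
  move=> /andP[xd xe] /andP[yd ye] _ xy; rewrite !fNE ltr_pM2l //.
  (* the horizontal increment starts from (a, y), not from (a, b): the radius d
     covers it because y is close to b *)
  have [yb|yb] := eqVneq y (ratr b); last first.
    have h1 : \sum_(p <- first_modes mn N) mode_term (ratr a) (ratr b) p <
        \sum_(p <- first_modes mn N) mode_term (ratr a) y p.
      by apply: eP; rewrite // subrr normr0.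
    have [->//|xa] := eqVneq x (ratr a).
    by apply: lt_trans h1 _; exact: dP.
  rewrite yb; apply: dP; rewrite ?subrr ?normr0 //.
  by apply: contraNneq xy => ->; rewrite yb.
Qed.
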